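(* Consider the setting described in the context, and fix an initial pair $(t,x)$, i.e. $t\in\mathbb{T}$ and $x\in L^2_{\mathcal{F}}(t;\mathbb{R}^n)$. The following statements are equivalent. (i) There exists an open-loop equilibrium control of Problem (LQ) for the initial pair $(t,x)$. (ii) There exists a control $u^{t,x,*}\in L^2_{\mathcal{F}}(\mathbb{T}_t;\mathbb{R}^m)$ such that, letting $X^{t,x,*}$ be defined by $$X^{t,x,*}_{k+1}=A_{k,k}X^{t,x,*}_k+B_{k,k}u^{t,x,*}_k+\big(C_{k,k}X^{t,x,*}_k+D_{k,k}u^{t,x,*}_k\big)w_k,\quad X^{t,x,*}_t=x,\ k\in\mathbb{T}_t,$$ for every $k\in\mathbb{T}_t$ the forward-backward stochastic difference equation $$\begin{cases}X^{k,*}_{\ell+1}=A_{k,\ell}X^{k,*}_\ell+B_{k,\ell}u^{t,x,*}_\ell+\big(C_{k,\ell}X^{k,*}_\ell+D_{k,\ell}u^{t,x,*}_\ell\big)w_\ell,\\ Z^{k,*}_\ell=A_{k,\ell}^T\mathbb{E}(Z^{k,*}_{\ell+1}\mid\mathcal{F}_{\ell-1})+C_{k,\ell}^T\mathbb{E}(Z^{k,*}_{\ell+1}w_\ell\mid\mathcal{F}_{\ell-1})+Q_{k,\ell}X^{k,*}_\ell,\\ X^{k,*}_k=X^{t,x,*}_k,\quad Z^{k,*}_N=G_kX^{k,*}_N,\quad \ell\in\mathbb{T}_k\end{cases}$$ has a solution $(X^{k,*},Z^{k,*})$ satisfying the stationary condition $$0=R_{k,k}u^{t,x,*}_k+B_{k,k}^T\mathbb{E}(Z^{k,*}_{k+1}\mid\mathcal{F}_{k-1})+D_{k,k}^T\mathbb{E}(Z^{k,*}_{k+1}w_k\mid\mathcal{F}_{k-1}),$$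 and the convexity condition $$\inf_{\bar u_k\in L^2_{\mathcal{F}}(k;\mathbb{R}^m)}\Big\{\sum_{\ell=k}^{N-1}\mathbb{E}\big[(Y^k_\ell)^TQ_{k,\ell}Y^k_\ell\big]+\mathbb{E}\big[\bar u_k^TR_{k,k}\bar u_k\big]+\mathbb{E}\big[(Y^k_N)^TG_kY^k_N\big]\Big\}\ge 0$$ holds, where $Y^k$ is given by $Y^k_k=0$, $Y^k_{k+1}=B_{k,k}\bar u_k+D_{k,k}\bar u_kw_k$, and $Y^k_{\ell+1}=A_{k,\ell}Y^k_\ell+C_{k,\ell}Y^k_\ell w_\ell$ for $\ell\in\mathbb{T}_{k+1}$. Furthermore, any $u^{t,x,*}$ as in (ii) is an open-loop equilibrium control of Problem (LQ) for the initial pair $(t,x)$.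
   Context: Let $N$ be a positive integer, $\mathbb{T}=\{0,1,\dots,N-1\}$, $\mathbb{T}_t=\{t,\dots,N-1\}$ and $\widetilde{\mathbb{T}}_t=\{t,\dots,N\}$. On a probability space $(\Omega,\mathcal{F},P)$, $\{w_k\}$ is a scalar martingale difference sequence with $\mathbb{E}[w_{k+1}\mid\mathcal{F}_k]=0$ and $\mathbb{E}[w_{k+1}^2\mid\mathcal{F}_k]=1$ for $k\ge0$, where $\mathcal{F}_k=\sigma\{x_0,w_l,\ l=0,\dots,k\}$ and $\mathcal{F}_{-1}=\{\emptyset,\Omega\}$. For a Euclidean space $\mathcal{H}$, $L^2_{\mathcal{F}}(\mathbb{T}_t;\mathcal{H})$ is the set of $\mathcal{H}$-valued processes $\nu=\{\nu_k,k\in\mathbb{T}_t\}$ with each $\nu_k$ $\mathcal{F}_{k-1}$-measurable and $\sum_{k=t}^{N-1}\mathbb{E}|\nu_k|^2<\infty$; $L^2_{\mathcal{F}}(k;\mathcal{H})$ is the set of $\mathcal{F}_{k-1}$-measurable $\mathcal{H}$-valued random variables $\xi$ with $\mathbb{E}|\xi|^2<\infty$. For each $t\in\mathbb{T}$, $k\in\mathbb{T}_t$, let $A_{t,k},C_{t,k}\in\mathbb{R}^{n\times n}$, $B_{t,k},D_{t,k}\in\mathbb{R}^{n\times m}$ be deterministic matrices and $Q_{t,k}\in\mathbb{R}^{n\times n}$, $R_{t,k}\in\mathbb{R}^{m\times m}$, $G_t\in\mathbb{R}^{n\times n}$ deterministic symmetric matrices (no definiteness assumed). For $t\in\mathbb{T}$,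 $y\in L^2_{\mathcal{F}}(t;\mathbb{R}^n)$ and $u\in L^2_{\mathcal{F}}(\mathbb{T}_t;\mathbb{R}^m)$, the state $X^t$ solves $X^t_{k+1}=A_{t,k}X^t_k+B_{t,k}u_k+(C_{t,k}X^t_k+D_{t,k}u_k)w_k$, $X^t_t=y$, $k\in\mathbb{T}_t$, and the cost is $$J(t,y;u)=\sum_{k=t}^{N-1}\mathbb{E}\big[(X^t_k)^TQ_{t,k}X^t_k+u_k^TR_{t,k}u_k\big]+\mathbb{E}\big[(X^t_N)^TG_tX^t_N\big].$$ Problem (LQ) is to minimize $J(t,x;u)$ over $u\in L^2_{\mathcal{F}}(\mathbb{T}_t;\mathbb{R}^m)$. A control $u^{t,x,*}\in L^2_{\mathcal{F}}(\mathbb{T}_t;\mathbb{R}^m)$ is an open-loop equilibrium control of Problem (LQ) for the initial pair $(t,x)$ if for every $k\in\mathbb{T}_t$ and every $u_k\in L^2_{\mathcal{F}}(k;\mathbb{R}^m)$, $$J(k,X^{t,x,*}_k;u^{t,x,*}|_{\mathbb{T}_k})\le J(k,X^{t,x,*}_k;(u_k,u^{t,x,*}|_{\mathbb{T}_{k+1}})),$$ where $u^{t,x,*}|_{\mathbb{T}_k}$ denotes restriction to $\mathbb{T}_k$, $(u_k,u^{t,x,*}|_{\mathbb{T}_{k+1}})$ is the control equal to $u_k$ at time $k$ and to $u^{t,x,*}$ afterwards, and $X^{t,x,*}_{k+1}=A_{k,k}X^{t,x,*}_k+B_{k,k}u^{t,x,*}_k+(C_{k,k}X^{t,x,*}_k+D_{k,k}u^{t,x,*}_k)w_k$,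 $X^{t,x,*}_t=x$.
   Formalization: The noise conditions are assumed for w_0 as well (E[w_0]=0 and E[w_0^2]=1, with the trivial F_{-1}), whereas the context states them only for w_{k+1} with k≥0; without a finite second moment of w_0 the claim fails at t=0. *)

(* Defs.v *)
From HB Require Import structures.
From mathcomp Require Import all_boot all_order all_algebra.
From mathcomp Require Import all_classical all_reals all_analysis.
Set Implicit Arguments. Unset Strict Implicit. Unset Printing Implicit Defensive.
Import Order.TTheory GRing.Theory Num.Theory.
Local Open Scope classical_set_scope.
Local Open Scope ring_scope.

Record LQdata (R : realType) (n m : nat) := MkLQdata {
  lqA : nat -> nat -> 'M[R]_n;
  lqB : nat -> nat -> 'M[R]_(n, m);
  lqC : nat -> nat -> 'M[R]_n;
  lqD : nat -> nat -> 'M[R]_(n, m);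
  lqQ : nat -> nat -> 'M[R]_n;
  lqR : nat -> nat -> 'M[R]_m;
  lqG : nat -> 'M[R]_n }.

Section LQ.
Context {d : measure_display} {T : measurableType d} {R : realType}
  (P : probability T R).

Definition gen_sigma (fs : set (T -> R)) : set (set T) :=
  smallest (sigma_algebra setT)
    [set A | exists f, fs f /\ exists B : set R, measurable B /\ A = f @^-1` B].

(* Filt x0 w j = F_{j-1}:  Filt 0 = F_{-1} = {emptyset, Omega},
   Filt (k+1) = F_k = sigma{x0, w_0, ..., w_k}. *)
Definition Filt (n : nat) (x0 : T -> 'cV[R]_n) (w : nat -> T -> R) (j : nat)
  : set (set T) :=
  gen_sigma [set f | ((0 < j)%N /\ exists i : 'I_n, f = fun om => x0 om i 0)
                     \/ exists l, (l < j)%N /\ f = w l].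

Definition meas_wrt (G : set (set T)) (f : T -> R) : Prop :=
  forall B : set R, measurable B -> G (f @^-1` B).

Definition L2 (G : set (set T)) (p : nat) (v : T -> 'cV[R]_p) : Prop :=
  forall i : 'I_p, meas_wrt G (fun om => v om i 0) /\
    P.-integrable setT (fun om => ((v om i 0) ^+ 2)%:E).

Definition condexp (G : set (set T)) (X Y : T -> R) : Prop :=
  [/\ meas_wrt G Y, P.-integrable setT (EFin \o X),
      P.-integrable setT (EFin \o Y) &
      forall A, G A -> (\int[P]_(om in A) (Y om)%:E = \int[P]_(om in A) (X om)%:E)%E].

Definition condexpV (G : set (set T)) (p : nat) (X Y : T -> 'cV[R]_p) : Prop :=
  forall i : 'I_p, condexp G (fun om => X om i 0) (fun om => Y om i 0).

Definition qf (p : nat) (M : 'M[R]_p) (v : 'cV[R]_p) : R := (v^T *m M *m v) 0 0.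

Fixpoint state (n m : nat) (A C : nat -> 'M[R]_n) (B D : nat -> 'M[R]_(n, m))
  (w : nat -> T -> R) (u : nat -> T -> 'cV[R]_m) (k0 : nat) (y : T -> 'cV[R]_n)
  (j : nat) : T -> 'cV[R]_n :=
  match j with
  | 0 => y
  | j'.+1 => if (j' < k0)%N then y else
      fun om => A j' *m state A C B D w u k0 y j' om + B j' *m u j' om
        + w j' om *: (C j' *m state A C B D w u k0 y j' om + D j' *m u j' om)
  end.

Variables (n m N : nat) (L : LQdata R n m) (x0 : T -> 'cV[R]_n) (w : nat -> T -> R).

Let F := Filt x0 w.

Definition stateX (t : nat) (y : T -> 'cV[R]_n) (u : nat -> T -> 'cV[R]_m) :=
  state (lqA L t) (lqC L t) (lqB L t) (lqD L t) w u t y.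

Definition cost (t : nat) (y : T -> 'cV[R]_n) (u : nat -> T -> 'cV[R]_m) : \bar R :=
  (\sum_(t <= k < N)
      \int[P]_om (qf (lqQ L t k) (stateX t y u k om) + qf (lqR L t k) (u k om))%:E
   + \int[P]_om (qf (lqG L t) (stateX t y u N om))%:E)%E.

Definition L2ctrl (t : nat) (u : nat -> T -> 'cV[R]_m) : Prop :=
  forall k, (t <= k < N)%N -> L2 (F k) (u k).

Definition Xstar (t : nat) (x : T -> 'cV[R]_n) (u : nat -> T -> 'cV[R]_m) :=
  state (fun k => lqA L k k) (fun k => lqC L k k) (fun k => lqB L k k)
        (fun k => lqD L k k) w u t x.

Definition open_loop_equilibrium (t : nat) (x : T -> 'cV[R]_n)
  (u : nat -> T -> 'cV[R]_m) : Prop :=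
  L2ctrl t u /\
  forall k, (t <= k < N)%N -> forall v : T -> 'cV[R]_m, L2 (F k) v ->
    (cost k (Xstar t x u k) u
       <= cost k (Xstar t x u k) (fun j => if j == k then v else u j))%E.

(* the functional in the convexity condition, with
   Y^k_k = 0, Y^k_{k+1} = B ub + D ub w_k, Y^k_{l+1} = A Y^k_l + C Y^k_l w_l *)
Definition convex_functional (k : nat) (ub : T -> 'cV[R]_m) : \bar R :=
  let Y := stateX k (fun _ => 0) (fun j => if j == k then ub else fun _ => 0) in
  (\sum_(k <= l < N) \int[P]_om (qf (lqQ L k l) (Y l om))%:E
   + \int[P]_om (qf (lqR L k k) (ub om))%:E
   + \int[P]_om (qf (lqG L k) (Y N om))%:E)%E.

Definition condition_ii (t : nat) (x : T -> 'cV[R]_n) (u : nat -> T -> 'cV[R]_m)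
  : Prop :=
  forall k, (t <= k < N)%N ->
    let Xk := stateX k (Xstar t x u k) u in
    (exists Z : nat -> T -> 'cV[R]_n,
      (forall om, Z N om = lqG L k *m Xk N om) /\
      (forall l, (k <= l < N)%N ->
         exists Y1 Y2 : T -> 'cV[R]_n,
           [/\ condexpV (F l) (Z l.+1) Y1,
               condexpV (F l) (fun om => w l om *: Z l.+1 om) Y2 &
               {ae P, forall om, Z l om = (lqA L k l)^T *m Y1 om
                   + (lqC L k l)^T *m Y2 om + lqQ L k l *m Xk l om}]) /\
      (exists Y1 Y2 : T -> 'cV[R]_n,
           [/\ condexpV (F k) (Z k.+1) Y1,
               condexpV (F k) (fun om => w k om *: Z k.+1 om) Y2 &
               {ae P, forall om, 0 = lqR L k k *m u k om
                   + (lqB L k k)^T *m Y1 om + (lqD L k k)^T *m Y2 om}])) /\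
    (0 <= ereal_inf [set convex_functional k ub | ub in [set ub | L2 (F k) ub]])%E.

End LQ.

(* Main.v *)
(* For a control u and a perturbation v of u at the single time k, the cost of
   the perturbed control is J(u) + 2 E<S_k, v> + Phi_k(v), where Phi_k is the
   quadratic functional of the convexity condition and S_k is the right-hand
   side of the stationary condition: pairing the backward variable Z with the
   perturbation Y of the state, and moving the conditional expectations onto
   the adapted factor, telescopes the first-order terms to E<S_k, v>.  Replacing
   v by c v and letting c range over the reals, u is optimal at k iff
   E<S_k, v> = 0 and Phi_k(v) >= 0 for all v, and v = S_k gives S_k = 0 almost
   surely.  All pairings are finite because E(Z w_k | F_{k-1}) is square
   integrable when Z is, thanks to E(w_k^2 | F_{k-1}) = 1. *)
Require Import Defs.
From HB Require Import structures.
From mathcomp Require Import all_boot all_order all_algebra.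
From mathcomp Require Import all_classical all_reals all_analysis.
From mathcomp Require Import measurable_realfun zify ring lra.
Import Order.TTheory GRing.Theory Num.Theory.
Import numFieldNormedType.Exports.
Local Open Scope classical_set_scope.
Local Open Scope ring_scope.

Set Implicit Arguments.
Unset Strict Implicit.
Unset Printing Implicit Defensive.

(** * Conditional expectations *)

Section SubSigmaAlgebra.
Context {d : measure_display} {T : measurableType d} {R : realType}.
Variables (P : probability T R) (G : set (set T)).
Hypotheses (sG : sigma_algebra setT G) (GT : G `<=` measurable).

(** The set [T] equipped with [G] as its sigma-algebra. Through [meas_wrtP], closure properties of
    measurable functions and approximation by simple functions become available for [meas_wrt G]. *)
Let TG := g_sigma_algebraType G.

Let measG (A : set TG) : measurable A = G A.
Proof. by rewrite -[in RHS](measurable_g_measurableTypeE sG). Qed.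

Lemma meas_wrtP (f : T -> R) :
  meas_wrt G f <-> measurable_fun (setT : set TG) (f : TG -> R).
Proof.
split=> [mf _ B mB|mf B mB].
  by rewrite setTI measG; exact: mf.
by rewrite -measG -[X in measurable X]setTI; exact: mf.
Qed.

Lemma meas_wrt_measurable (f : T -> R) : meas_wrt G f -> measurable_fun setT f.
Proof. by move=> mf _ B mB; rewrite setTI; exact/GT/mf. Qed.

Lemma meas_wrt_cst (c : R) : meas_wrt G (fun=> c).
Proof. by apply/meas_wrtP; exact: measurable_cst. Qed.

Lemma meas_wrtD (f g : T -> R) :
  meas_wrt G f -> meas_wrt G g -> meas_wrt G (fun x => f x + g x).
Proof. by move=> /meas_wrtP mf /meas_wrtP mg; apply/meas_wrtP/measurable_funD. Qed.

Lemma meas_wrtM (f g : T -> R) :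
  meas_wrt G f -> meas_wrt G g -> meas_wrt G (fun x => f x * g x).
Proof. by move=> /meas_wrtP mf /meas_wrtP mg; apply/meas_wrtP/measurable_funM. Qed.

Lemma meas_wrt_comp (h : R -> R) (f : T -> R) :
  measurable_fun setT h -> meas_wrt G f -> meas_wrt G (fun x => h (f x)).
Proof.
move=> mh mf B mB; rewrite -[_ @^-1` B]/(f @^-1` (h @^-1` B)).
by apply: mf; rewrite -[X in measurable X]setTI; exact: mh.
Qed.

Import HBNNSimple.

(** Approximate [f] from below by [G]-simple functions. For a simple factor the integral is a finite
    combination of integrals over level sets, which belong to [G], where [g1] and [g2] cannot be
    told apart; monotone convergence does the rest. No integrability is assumed, so the lemma also
    serves to prove finiteness. *)
Lemma ge0_integral_mul_meas_wrt (g1 g2 f : T -> R) :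
  measurable_fun setT g1 -> measurable_fun setT g2 ->
  (forall x, 0 <= g1 x) -> (forall x, 0 <= g2 x) ->
  (forall A, G A ->
    \int[P]_(x in A) (g1 x)%:E = \int[P]_(x in A) (g2 x)%:E)%E ->
  meas_wrt G f -> (forall x, 0 <= f x) ->
  (\int[P]_x (f x * g1 x)%:E = \int[P]_x (f x * g2 x)%:E)%E.
Proof.
move=> mg1 mg2 g10 g20 g12 /meas_wrtP mf f0.
have mfE : measurable_fun (setT : set TG) (EFin \o f : TG -> \bar R).
  exact/measurable_EFinP.
(* The approximation is taken on [TG], not on [T], so that its level sets lie in [G]. *)
pose h := nnsfun_approx measurableT mfE.
have mh n : measurable_fun setT (h n : T -> R).
  by apply: meas_wrt_measurable; apply/meas_wrtP; exact: measurable_funP.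
(* In this limit [g] enters only through its integrals over level sets of [h n]. *)
have key (g : T -> R) : measurable_fun setT g -> (forall x, 0 <= g x) ->
  (\int[P]_x (f x * g x)%:E =
   limn (fun n => \sum_(r \in range (h n))
     r%:E * \int[P]_(x in h n @^-1` [set r]) (g x)%:E))%E.
  move=> mg g0.
  have fg x : (f x * g x)%:E = limn (fun n => (h n x * g x)%:E).
    apply/esym/cvg_lim => //.
    rewrite EFinM; under eq_fun do rewrite EFinM.
    apply: cvgeZr => //; apply: cvg_nnsfun_approx => //= y _.
    by rewrite lee_fin.
  under eq_integral do rewrite fg.
  rewrite monotone_convergence//; first last.
  - move=> x _ a b ab; rewrite lee_fin ler_wpM2r//.
    by have /lefP := nd_nnsfun_approx measurableT mfE ab; exact.
  - by move=> n x _; rewrite lee_fin mulr_ge0.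
  - by move=> n; apply/measurable_EFinP/measurable_funM.
  congr (limn _); apply/funext => n.
  transitivity (\int[P]_x (\sum_(r \in range (h n))
     (r * \1_(h n @^-1` [set r]) x)%:E * (g x)%:E))%E.
    apply: eq_integral => x _.
    rewrite -ge0_mule_fsuml; last by move=> y; exact: nnfun_muleindic_ge0.
    by rewrite fsumEFin// -(fimfunE (h n)) EFinM.
  have mpre r : measurable (h n @^-1` [set r] : set T).
    by rewrite -[X in measurable X]setTI; exact: mh.
  rewrite ge0_integral_fsum//; last 2 first.
  - move=> r; apply/measurable_EFinP/measurable_funM => //.
    by apply: measurable_funM => //; exact: measurable_indic.
  - by move=> r x _; apply: mule_ge0; [exact: nnfun_muleindic_ge0|rewrite lee_fin].
  (* As a value of [h n], the scalar [r] is nonnegative, which allows it to leave the integral. *)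
  apply: eq_fsbigr => r; rewrite inE => -[x0 _ <-].
  under eq_integral do rewrite EFinM -muleA.
  rewrite ge0_integralZl_EFin//; last 2 first.
  - by move=> x _; rewrite lee_fin mulr_ge0.
  - by apply/measurable_EFinP/measurable_funM => //; exact: measurable_indic.
  congr (_ * _)%E; rewrite [RHS]integral_mkcond.
  by apply: eq_integral => x _; rewrite epatch_indic muleC.
rewrite !key//; congr (limn _); apply/funext => n.
apply: eq_fsbigr => r _; congr (_ * _)%E; apply: g12.
by rewrite -measG -[X in measurable X]setTI; exact: measurable_funP.
Qed.

End SubSigmaAlgebra.

(** * Integrable real random variables *)

Section Integrable.
Context {d : measure_display} {T : measurableType d} {R : realType}.
Variable P : probability T R.
Local Notation L1 f := (P.-integrable setT (EFin \o f)).

Lemma integrable_measurable (f : T -> R) : L1 f -> measurable_fun setT f.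
Proof. by move=> /measurable_int /measurable_EFinP. Qed.

Lemma integrable_dominated (f g : T -> R) : measurable_fun setT f ->
  (forall x, `|f x| <= g x) -> L1 g -> L1 f.
Proof.
move=> mf fg; apply: le_integrable => //; first exact/measurable_EFinP.
by move=> x _ /=; rewrite lee_fin (le_trans (fg x))// ler_norm.
Qed.

Lemma integrable_addr (f g : T -> R) : L1 f -> L1 g -> L1 (fun x => f x + g x).
Proof. by move=> If Ig; apply: eq_integrable (integrableD _ If Ig). Qed.

Lemma integrable_scaler (c : R) (f : T -> R) : L1 f -> L1 (fun x => c * f x).
Proof. by move=> If; apply: eq_integrable (integrableZl _ c If). Qed.

Lemma integrable_sumr n (f : 'I_n -> T -> R) :
  (forall i, L1 (f i)) -> L1 (fun x => \sum_(i < n) f i x).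
Proof.
move=> If; apply: eq_integrable (integrable_sum _ (index_enum _) _) => //.
  by move=> x _; rewrite /= -sumEFin.
by move=> i _; exact: If.
Qed.

Lemma integral_EFinE (f : T -> R) : L1 f ->
  (\int[P]_x (f x)%:E = (\int[P]_x f x)%:E)%E.
Proof. by move=> If; rewrite /Rintegral fineK//; exact: integrable_fin_num If. Qed.

Lemma Rintegral_sumr n (f : 'I_n -> T -> R) : (forall i, L1 (f i)) ->
  \int[P]_x (\sum_(i < n) f i x) = \sum_(i < n) \int[P]_x f i x.
Proof.
elim: n f => [|n IH] f If.
  by under eq_Rintegral do rewrite big_ord0; rewrite big_ord0 Rintegral_cst// mul0r.
under eq_Rintegral do rewrite big_ord_recl.
rewrite RintegralD//; last by apply: integrable_sumr => i; exact: If.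
by rewrite big_ord_recl IH// => i; exact: If.
Qed.

Lemma ae_eq_Rintegral (f g : T -> R) :
  measurable_fun setT f -> measurable_fun setT g ->
  {ae P, forall x, f x = g x} -> \int[P]_x f x = \int[P]_x g x.
Proof.
move=> mf mg fg; congr fine; apply: ae_eq_integral => //;
  [exact/measurable_EFinP..|].
by apply: filterS fg => x /= fg _; rewrite fg.
Qed.

(** Measurability of [g] is a separate hypothesis: the probability is not assumed complete, so
    almost sure equality does not transfer it. *)
Lemma ae_eq_integrable (f g : T -> R) : measurable_fun setT g ->
  {ae P, forall x, f x = g x} -> L1 f -> L1 g.
Proof.
move=> mg fg If; have /integrableP[mf ifoo] := If.
apply/integrableP; split; first exact/measurable_EFinP.
rewrite (le_lt_trans _ ifoo)//; apply: ae_ge0_le_integral => //.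
- by apply: measurableT_comp => //; exact/measurable_EFinP.
- by apply: measurableT_comp.
- by apply: filterS fg => x /= -> _.
Qed.

Lemma Rintegral_ge0_eq0 (f : T -> R) : L1 f -> (forall x, 0 <= f x) ->
  \int[P]_x f x = 0 -> {ae P, forall x, f x = 0}.
Proof.
move=> If f0 Ef0.
have If0 : (\int[P]_x (f x)%:E = 0)%E by rewrite integral_EFinE// Ef0.
have [+ _] := ae_eq_integral_abs P measurableT (measurable_int _ If).
under eq_integral => x _ do rewrite /= ger0_norm//.
by move=> /(_ If0); apply: filterS => x /(_ I) [].
Qed.

End Integrable.

(** * Conditional expectation: pulling out factors, existence, second moments *)

Section CondExp.
Context {d : measure_display} {T : measurableType d} {R : realType}.
Variables (P : probability T R) (G : set (set T)).
Hypotheses (sG : sigma_algebra setT G) (GT : G `<=` measurable).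
Local Notation L1 f := (P.-integrable setT (EFin \o f)).

(* [X] and [Y] are made nonnegative by adding [K = |X| + |Y|] to both. *)
Lemma ge0_condexp_pull (X Y f : T -> R) : condexp P G X Y ->
  meas_wrt G f -> (forall x, 0 <= f x) ->
  L1 (fun x => f x * X x) -> L1 (fun x => f x * Y x) ->
  \int[P]_x (f x * X x) = \int[P]_x (f x * Y x).
Proof.
move=> [_ IX IY XY] mf f0 IfX IfY.
have [mX mY] := (integrable_measurable IX, integrable_measurable IY).
have mF := meas_wrt_measurable GT mf.
have mnorm (Z : T -> R) : measurable_fun setT Z -> measurable_fun setT (fun x => `|Z x|).
  by move=> mZ; exact: measurableT_comp.
have Inorm (Z : T -> R) : L1 Z -> L1 (fun x => `|Z x|).
  move=> IZ; apply: integrable_dominated (integrable_norm IZ).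
    exact/mnorm/integrable_measurable/IZ.
  by move=> x; rewrite normr_id.
pose K x := `|X x| + `|Y x|.
have mK : measurable_fun setT K by apply: measurable_funD; exact: mnorm.
have IK : L1 K by apply: integrable_addr; exact: Inorm.
(* Since [f] may be unbounded, this rests on the two product hypotheses: [f * K] equals
   [|f X| + |f Y|]. *)
have IfK : L1 (fun x => f x * K x).
  apply: integrable_dominated (integrable_addr (Inorm _ IfX) (Inorm _ IfY)).
    exact: measurable_funM.
  move=> x; rewrite ger0_norm ?mulr_ge0 ?addr_ge0//.
  by rewrite /K mulrDr !normrM (ger0_norm (f0 x)).
have := @ge0_integral_mul_meas_wrt _ _ _ P G sG GT
  (fun x => X x + K x) (fun x => Y x + K x) f.
have step (Z : T -> R) : L1 (fun x => f x * Z x) ->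
    (\int[P]_x (f x * (Z x + K x))%:E =
    (\int[P]_x (f x * Z x) + \int[P]_x (f x * K x))%:E)%E.
  move=> IfZ; rewrite -RintegralD// -integral_EFinE.
    by apply: eq_integral => x _; rewrite mulrDr.
  exact: integrable_addr.
rewrite !step// => H.
apply: (addIr (\int[P]_x (f x * K x))); apply: EFin_inj; apply: H => //.
- exact: measurable_funD.
- exact: measurable_funD.
- by move=> x; have := ler_norm (- X x); have := normr_ge0 (Y x); rewrite normrN /K; lra.
- by move=> x; have := ler_norm (- Y x); have := normr_ge0 (X x); rewrite normrN /K; lra.
- move=> A GA; have mA := GT GA.
  have IS (Z : T -> R) : L1 Z -> P.-integrable A (EFin \o Z).
    exact: integrableS.
  under eq_integral do rewrite EFinD.
  under [RHS]eq_integral do rewrite EFinD.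
  rewrite integralD//; [|exact: IS..].
  rewrite integralD//; [|exact: IS..].
  by rewrite XY.
Qed.

(** Split [f] into positive and negative parts. Both are [G]-measurable and bounded by [|f|], so
    their products with [X] and [Y] stay integrable and the nonnegative case applies to each. *)
Lemma condexp_pull (X Y f : T -> R) : condexp P G X Y -> meas_wrt G f ->
  L1 (fun x => f x * X x) -> L1 (fun x => f x * Y x) ->
  \int[P]_x (f x * X x) = \int[P]_x (f x * Y x).
Proof.
move=> cXY mf IfX IfY.
have [_ IX IY _] := cXY.
have [mX mY] := (integrable_measurable IX, integrable_measurable IY).
pose pos (r : R) := Num.max r 0.
have mpos : measurable_fun setT pos by exact: measurable_maxr.
have mneg : measurable_fun setT (fun r : R => pos (- r)).
  by apply: measurable_maxr => //; exact: measurable_funN.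
have mfp := meas_wrt_comp mpos mf.
have mfn := meas_wrt_comp mneg mf.
have pos0 r : 0 <= pos r by rewrite /pos le_max lexx orbT.
have posE r : r = pos r - pos (- r).
  by rewrite /pos; case: (lerP r 0); case: (lerP (- r) 0); lra.
have posle r : pos r <= `|r| by rewrite /pos ge_max ler_norm normr_ge0.
have Ip (Z : T -> R) : measurable_fun setT Z -> L1 (fun x => f x * Z x) ->
    L1 (fun x => pos (f x) * Z x).
  move=> mZ /integrable_norm; apply: integrable_dominated.
    by apply: measurable_funM => //; exact: meas_wrt_measurable mfp.
  by move=> x; rewrite /= !normrM ler_wpM2r// ger0_norm.
have In (Z : T -> R) : measurable_fun setT Z -> L1 (fun x => f x * Z x) ->
    L1 (fun x => pos (- f x) * Z x).
  move=> mZ /integrable_norm; apply: integrable_dominated.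
    by apply: measurable_funM => //; exact: meas_wrt_measurable mfn.
  by move=> x; rewrite /= !normrM ler_wpM2r// ger0_norm// -(normrN (f x)).
have E (Z : T -> R) : measurable_fun setT Z -> L1 (fun x => f x * Z x) ->
    \int[P]_x (f x * Z x) =
    \int[P]_x (pos (f x) * Z x) - \int[P]_x (pos (- f x) * Z x).
  move=> mZ IfZ; rewrite -RintegralB//; [|exact: Ip|exact: In].
  by apply: eq_Rintegral => x _; rewrite {1}(posE (f x)) mulrBl.
rewrite !E//; congr (_ - _); apply: ge0_condexp_pull => //;
  by [exact: Ip|exact: In].
Qed.

Let TG := g_sigma_algebraType G.

(** The conditional expectation is the Radon-Nikodym derivative, on [G], of the charge sending [A]
    to the integral of [X] over [A], with respect to the restriction of [P]. *)
Lemma condexp_exists (X : T -> R) : L1 X -> exists Y, condexp P G X Y.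
Proof.
move=> IX.
have measG (A : set TG) : measurable A = G A.
  by rewrite -[in RHS](measurable_g_measurableTypeE sG).
(* The identity is measurable from [T] to [TG] because [G] consists of measurable sets; pushing
   forward along it restricts a measure or a charge to [G]. *)
pose i : T -> TG := id.
have mi : measurable_fun setT i.
  by move=> _ A; rewrite measG setTI => /GT.
pose iM : {mfun T >-> TG} := HB.pack i (isMeasurableFun.Build _ _ _ _ _ mi).
pose mu := distribution P iM.
pose nu := measure_function_pushforward__canonical__charge_Charge
  (charge_induced_charge__canonical__charge_Charge IX) mi.
have nuE A : nu A = (\int[P]_(x in A) (X x)%:E)%E by [].
have numu : nu `<< mu.
  apply/null_content_dominatesP => A; rewrite measG => GA muA0.
  rewrite nuE; apply: null_set_integral => //; first exact: GT.
  exact/measurable_EFinP/measurable_funTS/integrable_measurable/IX.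
pose Y := Radon_Nikodym nu mu.
(* The derivative is finite at every point, so passing to [fine] loses nothing. *)
have YE x : (fine (Y x))%:E = Y x by rewrite fineK// Radon_Nikodym_fin_num.
have IY : mu.-integrable setT Y by exact: Radon_Nikodym_integrable.
have mY : measurable_fun (setT : set TG) (fine \o Y).
  by apply: measurableT_comp => //; exact: measurable_int IY.
have mwY : meas_wrt G (fine \o Y : T -> R) by exact/meas_wrtP.
have mYT := meas_wrt_measurable GT mwY.
have mYE := measurable_int _ IY.
have IYT : L1 (fine \o Y : T -> R).
  apply/integrableP; split; first exact/measurable_EFinP.
  have /integrableP[_] := IY; apply: le_lt_trans.
  rewrite [leRHS](ge0_integral_pushforward mi)//.
    by have -> : EFin \o (fine \o Y) = Y by apply/funext => x; exact: YE.
  exact: measurableT_comp.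
exists (fine \o Y); split => // A GA.
transitivity (nu A) => //.
rewrite (Radon_Nikodym_integral numu) ?measG//.
rewrite [RHS](integral_pushforward mi) ?measG//.
  by apply: eq_integral => x _; rewrite /= YE.
have mA := GT GA.
apply: eq_integrable (integrableS measurableT mA _ IYT) => //.
by move=> x _; rewrite /= YE.
Qed.

(* With [b] the truncation of [Y] at level [M],
   [2 E(b^2) = 2 E(b v Z) <= E(b^2 v^2) + E(Z^2) = E(b^2) + E(Z^2)],
   so that [E(b^2) <= E(Z^2)] uniformly in [M]. *)
Lemma condexp_sqr_integrable (v Z Y : T -> R) : measurable_fun setT v ->
  condexp P G (fun x => v x ^+ 2) (fun=> 1) ->
  measurable_fun setT Z -> L1 (fun x => Z x ^+ 2) ->
  condexp P G (fun x => v x * Z x) Y ->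
  L1 (fun x => Y x ^+ 2).
Proof.
move=> mv cv mZ IZ2 cY.
have [mwY IvZ IY _] := cY.
have mY := integrable_measurable IY.
have [_ Iv2 I1 _] := cv.
pose c : R := \int[P]_x (Z x ^+ 2).
(* Values beyond level [M] are sent to 0 rather than clipped to [M], which makes [h M y * y] exactly
   [h M y ^+ 2]. *)
pose h (M : nat) (y : R) : R := if `|y| <= M%:R then y else 0.
have mh M : measurable_fun setT (h M).
  apply: measurable_fun_ifT => //; apply: measurable_fun_ler => //.
have hY2 M y : h M y * y = h M y ^+ 2.
  by rewrite /h; case: ifP => _; rewrite ?mul0r ?expr0n// expr2.
have hM M y : `|h M y| <= M%:R.
  by rewrite /h; case: ifP => // _; rewrite normr0.
have mb M := meas_wrt_comp (mh M) mwY.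
have mbT M := meas_wrt_measurable GT (mb M).
have Ib M (f : T -> R) : L1 f -> L1 (fun x => h M (Y x) * f x).
  move=> If; have mf := integrable_measurable If.
  apply: integrable_dominated (integrable_scaler M%:R (integrable_norm If)).
    exact: measurable_funM.
  by move=> x; rewrite normrM ler_wpM2r.
have Ib2 M (f : T -> R) : L1 f -> L1 (fun x => h M (Y x) ^+ 2 * f x).
  move=> If; apply: eq_integrable (Ib M _ (Ib M _ If)) => // x _ /=.
  by rewrite expr2 mulrA.
have trunc M : \int[P]_x (h M (Y x) ^+ 2) <= c.
  have e1 : \int[P]_x (h M (Y x) * (v x * Z x)) = \int[P]_x (h M (Y x) ^+ 2).
    rewrite (condexp_pull cY (mb M)) ?Ib//.
    by apply: eq_Rintegral => x _; rewrite hY2.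
  have e2 : \int[P]_x (h M (Y x) ^+ 2 * v x ^+ 2) = \int[P]_x (h M (Y x) ^+ 2).
    rewrite (condexp_pull cv) ?Ib2//.
      by apply: eq_Rintegral => x _; rewrite mulr1.
    apply: (meas_wrt_comp (h := fun r => r ^+ 2) _ (mb M)).
    exact: exprn_measurable.
  have : \int[P]_x (2 * (h M (Y x) * (v x * Z x))) <=
         \int[P]_x (h M (Y x) ^+ 2 * v x ^+ 2 + Z x ^+ 2).
    apply: le_Rintegral => //.
    - exact/integrable_scaler/Ib.
    - by apply: integrable_addr => //; exact: Ib2.
    - move=> x _; rewrite -subr_ge0.
      rewrite [leRHS](_ : _ = (h M (Y x) * v x - Z x) ^+ 2) ?sqr_ge0//; ring.
  rewrite RintegralZl//; last exact: Ib.
  rewrite RintegralD//; last exact: Ib2.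
  by rewrite e1 e2 -/c; lra.
apply/integrableP; split; first exact/measurable_EFinP/measurable_funX.
under eq_integral do rewrite /= ger0_norm ?sqr_ge0//.
(* At each point the truncation is inactive as soon as [M] exceeds [|Y x|], so the squares increase
   to [Y x ^+ 2] and the uniform bound passes to the limit. *)
have lim2 x : (Y x ^+ 2)%:E = limn (fun M => (h M (Y x) ^+ 2)%:E).
  apply/esym/cvg_lim => //; apply: cvg_near_cst.
  exists (Num.truncn `|Y x|).+1 => // M /= YM.
  rewrite /h ifT//; apply: ltW; apply: lt_le_trans (truncnS_gt _) _.
  by rewrite ler_nat.
have nd x a b : (a <= b)%N -> ((h a (Y x) ^+ 2)%:E <= (h b (Y x) ^+ 2)%:E)%E.
  move=> ab; rewrite lee_fin /h.
  case: ifP => Ya; last by rewrite expr0n sqr_ge0.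
  by rewrite ifT// (le_trans Ya)// ler_nat.
have mh2 M : measurable_fun setT (fun x => (h M (Y x) ^+ 2)%:E).
  exact/measurable_EFinP/measurable_funX.
have h0 M x : (0 <= (h M (Y x) ^+ 2)%:E)%E by rewrite lee_fin sqr_ge0.
under eq_integral do rewrite lim2.
rewrite monotone_convergence//; last by move=> x _ a b; exact: nd.
apply: (@le_lt_trans _ _ c%:E); last exact: ltry.
apply: lime_le.
  apply: ereal_nondecreasing_is_cvgn => a b ab.
  by apply: ge0_le_integral => // x _; exact: nd.
apply: nearW => M; rewrite integral_EFinE ?lee_fin//.
by apply: eq_integrable (Ib2 M _ I1) => // x _; rewrite /= mulr1.
Qed.

(** Conditioning replaces [v ^+ 2] by 1 in front of the [G]-measurable factor [X ^+ 2], so the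
    second moment of [v * X] equals that of [X]. *)
Lemma meas_wrt_mul_sqr_integrable (v X : T -> R) : measurable_fun setT v ->
  condexp P G (fun x => v x ^+ 2) (fun=> 1) ->
  meas_wrt G X -> L1 (fun x => X x ^+ 2) -> L1 (fun x => (v x * X x) ^+ 2).
Proof.
move=> mv [_ _ _ cv] mwX IX2.
have mX := meas_wrt_measurable GT mwX.
apply/integrableP; split.
  exact/measurable_EFinP/measurable_funX/measurable_funM.
under eq_integral => x _ do rewrite /= ger0_norm ?sqr_ge0// exprMn mulrC.
rewrite (@ge0_integral_mul_meas_wrt _ _ _ P G sG GT _ (fun=> 1))//.
- under eq_integral do rewrite mulr1.
  by rewrite integral_EFinE// ltry.
- exact: measurable_funX.
- by move=> x; exact: sqr_ge0.
- by move=> A GA; rewrite cv.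
- by apply: (meas_wrt_comp (h := fun r => r ^+ 2)) => //; exact: exprn_measurable.
- by move=> x; exact: sqr_ge0.
Qed.

End CondExp.

(** * Square-integrable random vectors *)

Section DotProduct.
Context {R : realType}.

Definition dotv p (u v : 'cV[R]_p) : R := (u^T *m v) 0 0.

Lemma dotvE p (u v : 'cV[R]_p) : dotv u v = \sum_(i < p) u i 0 * v i 0.
Proof. by rewrite /dotv mxE; apply: eq_bigr => i _; rewrite mxE. Qed.

Lemma dotvC p (u v : 'cV[R]_p) : dotv u v = dotv v u.
Proof. by rewrite !dotvE; apply: eq_bigr => i _; rewrite mulrC. Qed.

Lemma dotvDl p (u u' v : 'cV[R]_p) : dotv (u + u') v = dotv u v + dotv u' v.
Proof. by rewrite /dotv linearD /= mulmxDl mxE. Qed.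

Lemma dotvDr p (u v v' : 'cV[R]_p) : dotv u (v + v') = dotv u v + dotv u v'.
Proof. by rewrite dotvC dotvDl !(dotvC u). Qed.

Lemma dotvZl p c (u v : 'cV[R]_p) : dotv (c *: u) v = c * dotv u v.
Proof. by rewrite /dotv linearZ /= -scalemxAl mxE. Qed.

Lemma dotvZr p c (u v : 'cV[R]_p) : dotv u (c *: v) = c * dotv u v.
Proof. by rewrite dotvC dotvZl dotvC. Qed.

Lemma dotv0l p (v : 'cV[R]_p) : dotv 0 v = 0.
Proof. by rewrite /dotv trmx0 mul0mx mxE. Qed.

Lemma dotv_mulmxl p q (A : 'M[R]_(q, p)) (u : 'cV[R]_p) (v : 'cV[R]_q) :
  dotv (A *m u) v = dotv u (A^T *m v).
Proof. by rewrite /dotv trmx_mul mulmxA. Qed.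

Lemma qfE p (M : 'M[R]_p) (v : 'cV[R]_p) : qf M v = dotv v (M *m v).
Proof. by rewrite /qf /dotv mulmxA. Qed.

(** Symmetry of [M] merges the two cross terms into one. *)
Lemma qfD p (M : 'M[R]_p) (u v : 'cV[R]_p) : M^T = M ->
  qf M (u + v) = qf M u + 2 * dotv (M *m u) v + qf M v.
Proof.
move=> sM; rewrite !qfE mulmxDr !dotvDl !dotvDr.
have -> : dotv v (M *m u) = dotv (M *m u) v by rewrite dotvC.
have -> : dotv u (M *m v) = dotv (M *m u) v by rewrite dotv_mulmxl sM.
by ring.
Qed.

Lemma qfZ p (M : 'M[R]_p) c (v : 'cV[R]_p) : qf M (c *: v) = c ^+ 2 * qf M v.
Proof. by rewrite !qfE -scalemxAr dotvZl dotvZr mulrA. Qed.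

Lemma dotv_eq0 p (u : 'cV[R]_p) : dotv u u = 0 -> u = 0.
Proof.
rewrite dotvE => /eqP; rewrite psumr_eq0 => [/allP u0|i _]; last exact: sqr_ge0.
apply/colP => i; rewrite mxE; apply/eqP.
by have := u0 i (mem_index_enum i); rewrite -expr2 sqrf_eq0.
Qed.

Lemma dotv_ge0 p (u : 'cV[R]_p) : 0 <= dotv u u.
Proof. by rewrite dotvE; apply: sumr_ge0 => i _; exact: sqr_ge0. Qed.

(* The test value [c = - a / (b + 1)] makes the quadratic negative unless [a = 0]. *)
Lemma quadratic_ge0 (a b : R) : (forall c, 0 <= 2 * (c * a) + c ^+ 2 * b) ->
  a = 0 /\ 0 <= b.
Proof.
move=> H; have b0 : 0 <= b by have := H 1; have := H (- 1); lra.
split => //; apply/eqP; rewrite -sqrf_eq0 eq_le sqr_ge0 andbT.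
have b1 : b + 1 != 0 by rewrite gt_eqF//; lra.
have := H (- a / (b + 1)).
have -> : 2 * (- a / (b + 1) * a) + (- a / (b + 1)) ^+ 2 * b =
    - (a ^+ 2 * ((b + 2) / (b + 1) ^+ 2)) by field.
by rewrite oppr_ge0 pmulr_lle0// divr_gt0 ?exprn_gt0//; lra.
Qed.

End DotProduct.

(** * Square-integrable variables and vectors *)

Section SquareIntegrable.
Context {d : measure_display} {T : measurableType d} {R : realType}.
Variable P : probability T R.
Local Notation L1 f := (P.-integrable setT (EFin \o f)).

(** Measurability is required apart from the second moment, since that of the square does not imply
    it. *)
Definition sqint (f : T -> R) :=
  measurable_fun setT f /\ L1 (fun x => f x ^+ 2).

Lemma sqintM f g : sqint f -> sqint g -> L1 (fun x => f x * g x).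
Proof.
move=> [mf If] [mg Ig]; apply: integrable_dominated (integrable_addr If Ig).
  exact: measurable_funM.
move=> x; rewrite ler_norml.
have := sqr_ge0 (f x + g x); have := sqr_ge0 (f x - g x).
have := sqr_ge0 (f x); have := sqr_ge0 (g x).
by rewrite sqrrB sqrrD; move=> *; apply/andP; split; lra.
Qed.

Lemma sqintD f g : sqint f -> sqint g -> sqint (fun x => f x + g x).
Proof.
move=> sf sg; have [[mf If] [mg Ig]] := (sf, sg); split.
  exact: measurable_funD.
have Ifg := integrable_addr If (integrable_addr Ig
  (integrable_scaler 2 (sqintM sf sg))).
by apply: eq_integrable Ifg => // x _; rewrite /= sqrrD; congr EFin; ring.
Qed.

Lemma sqintZ c f : sqint f -> sqint (fun x => c * f x).
Proof.
move=> [mf If]; split; first exact: measurable_funM.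
apply: eq_integrable (integrable_scaler (c ^+ 2) If) => // x _.
by rewrite /= exprMn.
Qed.

Lemma sqint_sum n (f : 'I_n -> T -> R) :
  (forall i, sqint (f i)) -> sqint (fun x => \sum_(i < n) f i x).
Proof.
elim: n f => [|n IH] f sf.
  under eq_fun do rewrite big_ord0; split; first exact: measurable_cst.
  by under eq_fun do rewrite expr0n; exact: integrable0.
under eq_fun do rewrite big_ord_recl.
by apply: sqintD => //; apply: IH.
Qed.

Lemma ae_eq_sqint f g : measurable_fun setT g ->
  {ae P, forall x, f x = g x} -> sqint f -> sqint g.
Proof.
move=> mg fg [mf If]; split => //.
apply: ae_eq_integrable If; first exact: measurable_funX.
by apply: filterS fg => x ->.
Qed.

Definition sqintV p (v : T -> 'cV[R]_p) := forall i, sqint (fun x => v x i 0).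

Lemma sqintVD p (u v : T -> 'cV[R]_p) :
  sqintV u -> sqintV v -> sqintV (fun x => u x + v x).
Proof. by move=> su sv i; under eq_fun do rewrite mxE; exact: sqintD. Qed.

Lemma sqintV_mulmx p q (A : 'M[R]_(q, p)) (u : T -> 'cV[R]_p) :
  sqintV u -> sqintV (fun x => A *m u x).
Proof.
move=> su i; under eq_fun do rewrite mxE.
by apply: sqint_sum => j; exact: sqintZ.
Qed.

Lemma integrable_dotv p (u v : T -> 'cV[R]_p) :
  sqintV u -> sqintV v -> L1 (fun x => dotv (u x) (v x)).
Proof.
move=> su sv; under eq_fun do rewrite dotvE.
by apply: integrable_sumr => i; exact: sqintM.
Qed.

Lemma integrable_qf p (M : 'M[R]_p) (v : T -> 'cV[R]_p) :
  sqintV v -> L1 (fun x => qf M (v x)).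
Proof.
move=> sv; under eq_fun do rewrite qfE.
by apply: integrable_dotv => //; exact: sqintV_mulmx.
Qed.

End SquareIntegrable.

(** * Conditional expectations of random vectors and the one-step adjoint *)

Section CondExpVector.
Context {d : measure_display} {T : measurableType d} {R : realType}.
Variables (P : probability T R) (G : set (set T)).
Hypotheses (sG : sigma_algebra setT G) (GT : G `<=` measurable).
Local Notation L1 f := (P.-integrable setT (EFin \o f)).

Lemma L2_sqintV p (v : T -> 'cV[R]_p) : L2 P G v -> sqintV P v.
Proof.
move=> Lv i; have [mv Iv] := Lv i; split=> //.
exact: meas_wrt_measurable mv.
Qed.

Lemma L2_cst0 p : L2 P G (fun=> 0 : 'cV[R]_p).
Proof.
move=> i; under eq_fun do rewrite mxE; split; first exact: meas_wrt_cst.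
by under eq_fun do rewrite mxE expr0n; exact: integrable0.
Qed.

Lemma L2D p (u v : T -> 'cV[R]_p) :
  L2 P G u -> L2 P G v -> L2 P G (fun x => u x + v x).
Proof.
move=> Lu Lv i; split; last first.
  by have [] := sqintVD (L2_sqintV Lu) (L2_sqintV Lv) i.
under eq_fun do rewrite mxE.
by apply: meas_wrtD => //; [have [] := Lu i | have [] := Lv i].
Qed.

Lemma meas_wrt_sum n (f : 'I_n -> T -> R) :
  (forall i, meas_wrt G (f i)) -> meas_wrt G (fun x => \sum_(i < n) f i x).
Proof.
elim: n f => [|n IH] f mf.
  by under eq_fun do rewrite big_ord0; exact: meas_wrt_cst.
under eq_fun do rewrite big_ord_recl.
by apply: meas_wrtD => //; apply: IH.
Qed.

Lemma L2_mulmx p q (A : 'M[R]_(q, p)) (u : T -> 'cV[R]_p) :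
  L2 P G u -> L2 P G (fun x => A *m u x).
Proof.
move=> Lu i; split; last first.
  by have [] := sqintV_mulmx A (L2_sqintV Lu) i.
under eq_fun do rewrite mxE; apply: meas_wrt_sum => j.
by apply: meas_wrtM => //; [exact: meas_wrt_cst | have [] := Lu j].
Qed.

Lemma L2Z p (c : R) (u : T -> 'cV[R]_p) :
  L2 P G u -> L2 P G (fun x => c *: u x).
Proof. by move=> /(L2_mulmx c%:M); under eq_fun do rewrite mul_scalar_mx. Qed.

(** Integrability is asked of the products and not of the square of [X], because the intended [X]
    includes the noise times [Z], which need not be square integrable. *)
Lemma Rintegral_dotv_pull p (X Y delta : T -> 'cV[R]_p) :
  condexpV P G X Y -> L2 P G delta -> sqintV P Y ->
  (forall i, L1 (fun x => delta x i 0 * X x i 0)) ->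
  \int[P]_x dotv (delta x) (X x) = \int[P]_x dotv (delta x) (Y x).
Proof.
move=> XY Ld sY IX; have sd := L2_sqintV Ld.
under eq_Rintegral do rewrite dotvE.
under [RHS]eq_Rintegral do rewrite dotvE.
have IY i : L1 (fun x => delta x i 0 * Y x i 0) by exact: sqintM.
rewrite !Rintegral_sumr//; apply: eq_bigr => i _.
by apply: (condexp_pull sG GT (XY i)) => //; have [] := Ld i.
Qed.

Section Noise.
Variable v : T -> R.
Hypotheses (mv : measurable_fun setT v)
  (cv : condexp P G (fun x => v x ^+ 2) (fun=> 1)).

Lemma sqint_noise : sqint P v.
Proof. by split=> //; have [] := cv. Qed.

Lemma sqintV_noiseZ p (u : T -> 'cV[R]_p) :
  L2 P G u -> sqintV P (fun x => v x *: u x).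
Proof.
move=> Lu i; under eq_fun do rewrite mxE; have [mu Iu] := Lu i; split.
  by apply: measurable_funM => //; exact: meas_wrt_measurable mu.
exact: (meas_wrt_mul_sqr_integrable sG).
Qed.

Lemma condexpV_noise_sqintV p (Z Y : T -> 'cV[R]_p) : sqintV P Z ->
  condexpV P G (fun x => v x *: Z x) Y -> sqintV P Y.
Proof.
move=> sZ cY i; have [mZ IZ] := sZ i; have ci := cY i.
have {}ci : condexp P G (fun x => v x * Z x i 0) (fun x => Y x i 0).
  by move: ci; under eq_fun do rewrite mxE.
split; first by have [_ _ /integrable_measurable] := ci.
exact: (condexp_sqr_integrable sG) ci.
Qed.

End Noise.

Lemma condexp_cst (c : R) : condexp P G (fun=> c) (fun=> c).
Proof.
have Ic : L1 (fun=> c) by exact: finite_measure_integrable_cst.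
by split=> //; exact: meas_wrt_cst.
Qed.

(** The case of a noise constantly equal to 1 in [condexpV_noise_sqintV]. *)
Lemma condexpV_sqintV p (Z Y : T -> 'cV[R]_p) : sqintV P Z ->
  condexpV P G Z Y -> sqintV P Y.
Proof.
move=> sZ cY; apply: (condexpV_noise_sqintV (v := fun=> 1) _ _ sZ).
- exact: measurable_cst.
- by under eq_fun do rewrite expr1n; exact: condexp_cst.
- by under eq_fun do rewrite scale1r.
Qed.

Lemma condexpV_exists p (X : T -> 'cV[R]_p) :
  (forall i, L1 (fun x => X x i 0)) -> exists Y, condexpV P G X Y.
Proof.
move=> IX; have /choice[Y XY] := fun i => condexp_exists sG GT (IX i).
exists (fun x => \col_i Y i x) => i.
by under [X in condexp _ _ _ X]eq_fun do rewrite mxE; exact: XY.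
Qed.

(** The adjoint, for the pairing [E<.,.>], of one step of the state equation. It is used with the
    pair [(A, C)] after the perturbation time and with [(B, D)] at that time. *)
Lemma Rintegral_dotv_adjoint n p (v : T -> R) (Z Y1 Y2 : T -> 'cV[R]_n)
    (M K : 'M[R]_(n, p)) (delta : T -> 'cV[R]_p) :
  measurable_fun setT v -> condexp P G (fun x => v x ^+ 2) (fun=> 1) ->
  sqintV P Z -> condexpV P G Z Y1 -> condexpV P G (fun x => v x *: Z x) Y2 ->
  L2 P G delta ->
  \int[P]_x dotv (Z x) (M *m delta x + v x *: (K *m delta x)) =
  \int[P]_x dotv (M^T *m Y1 x + K^T *m Y2 x) (delta x).
Proof.
move=> mv cv sZ c1 c2 Ld.
have sY1 := condexpV_sqintV sZ c1.
have sY2 := condexpV_noise_sqintV mv cv sZ c2.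
have LM := L2_mulmx M Ld; have LK := L2_mulmx K Ld.
have sM := L2_sqintV LM; have sK := L2_sqintV LK.
have svK := sqintV_noiseZ mv cv LK.
(* The scalar noise is moved from [K *m delta] onto [Z], leaving a [G]-measurable factor to be
   pulled out. *)
transitivity (\int[P]_x (dotv (M *m delta x) (Z x) +
                         dotv (K *m delta x) (v x *: Z x))).
  apply: eq_Rintegral => x _; rewrite dotvDr !(dotvC (Z x)).
  by rewrite dotvZl dotvZr.
transitivity (\int[P]_x (dotv (M *m delta x) (Y1 x) +
                         dotv (K *m delta x) (Y2 x))).
  (* Regrouped the other way: [v] times [K *m delta] is square integrable, and so is [Z]. *)
  have IKZ i : L1 (fun x => (K *m delta x) i 0 * (v x *: Z x) i 0).
    have := sqintM (svK i) (sZ i); apply: eq_integrable => // x _ /=.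
    by rewrite !mxE; congr EFin; ring.
  rewrite RintegralD//; first last.
  - by under eq_fun do rewrite dotvE; exact: integrable_sumr.
  - exact: integrable_dotv.
  rewrite RintegralD//; [|exact: integrable_dotv..].
  by congr (_ + _); apply: Rintegral_dotv_pull => // i; exact: sqintM.
apply: eq_Rintegral => x _.
by rewrite !dotv_mulmxl dotvDl !(dotvC (delta x)).
Qed.

End CondExpVector.

(** * The state equation, the cost and the backward equation *)

Section Filtration.
Context {d : measure_display} {T : measurableType d} {R : realType}.
Variables (P : probability T R) (n : nat) (x0 : T -> 'cV[R]_n) (w : nat -> T -> R).
Local Notation F := (Filt x0 w).

Lemma Filt_sigma_algebra j : sigma_algebra setT (F j).
Proof. exact: smallest_sigma_algebra. Qed.

Lemma Filt_measurable :
  (forall i : 'I_n, measurable_fun setT (fun om => x0 om i 0)) ->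
  (forall k, measurable_fun setT (w k)) -> forall j, F j `<=` measurable.
Proof.
move=> mx mw j; apply: smallest_sub; first exact: sigma_algebra_measurable.
move=> A [f [Ff [B [mB ->]]]]; rewrite -[X in measurable X]setTI.
by case: Ff => [[_ [i ->]]|[l [_ ->]]]; [exact: mx|exact: mw].
Qed.

Lemma Filt_mono i j : (i <= j)%N -> F i `<=` F j.
Proof.
move=> ij; apply: sub_smallest2r; first exact: Filt_sigma_algebra.
move=> A [f [Ff AB]]; exists f; split => //.
case: Ff => [[i0 fx]|[l [li fl]]]; [left|right].
  by split => //; exact: leq_trans ij.
by exists l; split => //; exact: leq_trans ij.
Qed.

Lemma Filt_noise j : meas_wrt (F j.+1) (w j).
Proof.
move=> B mB; apply: sub_gen_smallest; exists (w j); split; last by exists B.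
by right; exists j.
Qed.

Lemma L2_mono G G' p (v : T -> 'cV[R]_p) : G `<=` G' -> L2 P G v -> L2 P G' v.
Proof.
move=> GG' Lv i; have [mv Iv] := Lv i; split => // B mB.
exact/GG'/mv.
Qed.

End Filtration.

(** * Linearity of the state equation *)

Section State.
Context {d : measure_display} {T : measurableType d} {R : realType}.
Variables (n m : nat) (A C : nat -> 'M[R]_n) (B D : nat -> 'M[R]_(n, m))
  (w : nat -> T -> R) (k : nat).

Lemma state_init u y j : (j <= k)%N -> state A C B D w u k y j = y.
Proof. by case: j => //= j ->. Qed.

Lemma stateS u y j : (k <= j)%N -> state A C B D w u k y j.+1 =
  fun om => A j *m state A C B D w u k y j om + B j *m u j om
    + w j om *: (C j *m state A C B D w u k y j om + D j *m u j om).
Proof. by move=> kj; rewrite /= ltnNge kj. Qed.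

Lemma state_linear (c : R) u u' y y' j :
  state A C B D w (fun j om => u j om + c *: u' j om) k
    (fun om => y om + c *: y' om) j =
  fun om => state A C B D w u k y j om + c *: state A C B D w u' k y' j om.
Proof.
elim: j => [//|j IH] /=; case: ifP => // _; rewrite IH.
apply/funext => om; rewrite !mulmxDr -!scalemxAr !scalerDr !scalerA.
rewrite !(mulrC (w j om) c) -!scalerA.
rewrite [A j *m _ + _ + _]addrACA [w j om *: _ + _ + _]addrACA -!scalerDr.
by rewrite addrACA -scalerDr.
Qed.

Lemma stateZ (c : R) u y j :
  state A C B D w (fun j om => c *: u j om) k (fun om => c *: y om) j =
  fun om => c *: state A C B D w u k y j om.
Proof.
elim: j => [//|j IH] /=; case: ifP => // _; rewrite IH.
apply/funext => om; rewrite -!scalemxAr -!scalerDr scalerA (mulrC (w j om)).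
by rewrite -scalerA -scalerDr.
Qed.

End State.

(** * States and costs of the control problem *)

Section LQProblem.
Context {d : measure_display} {T : measurableType d} {R : realType}.
Variables (P : probability T R) (n m N : nat) (L : LQdata R n m).
Variables (x0 : T -> 'cV[R]_n) (w : nat -> T -> R).
Hypotheses
  (HQ : forall t k, (t <= k < N)%N -> (lqQ L t k)^T = lqQ L t k)
  (HR : forall t k, (t <= k < N)%N -> (lqR L t k)^T = lqR L t k)
  (HG : forall t, (t < N)%N -> (lqG L t)^T = lqG L t)
  (Hx0 : forall i : 'I_n, measurable_fun setT (fun om => x0 om i 0))
  (Hw : forall k, measurable_fun setT (w k))
  (Hvar : forall k, condexp P (Filt x0 w k) (fun om => w k om ^+ 2) (fun _ => 1)).
Local Notation L1 f := (P.-integrable setT (EFin \o f)).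
Local Notation F := (Filt x0 w).
Let sF := Filt_sigma_algebra x0 w.
Let FT j : F j `<=` measurable := Filt_measurable Hx0 Hw (j := j).

(** Induction on time: the drift and diffusion terms at [j] are in [L2 P (F j)], multiplication by
    [w j] preserves the second moment, and the product is measurable for [F j.+1]. The coefficients
    are arbitrary, so the lemma covers both [stateX] and [Xstar]. *)
Lemma state_L2 A C (B D : nat -> 'M[R]_(n, m)) u k y :
  L2 P (F k) y -> L2ctrl P N x0 w k u ->
  forall j, (k <= j <= N)%N -> L2 P (F j) (state A C B D w u k y j).
Proof.
move=> Ly Lu; elim=> [|j IH] /andP[kj jN].
  by move: kj Ly; rewrite leqn0 => /eqP ->.
move: kj; rewrite leq_eqVlt => /orP[/eqP <-|]; first by rewrite state_init.
rewrite ltnS => kj; rewrite stateS//.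
have LX : L2 P (F j) (state A C B D w u k y j) by apply: IH; rewrite kj ltnW.
have LU : L2 P (F j) (u j) by apply: Lu; rewrite kj.
have LDr (M : 'M[R]_n) (K : 'M[R]_(n, m)) :
    L2 P (F j) (fun om => M *m state A C B D w u k y j om + K *m u j om).
  by apply: (L2D (sF j) (@FT j)); apply: (L2_mulmx (sF j) (@FT j)).
apply: (L2D (sF j.+1) (@FT _)).
  by apply: L2_mono (LDr _ _); exact: Filt_mono.
move=> i; split; last first.
  by have [] := sqintV_noiseZ (sF j) (@FT _) (Hw j) (Hvar j) (LDr (C j) (D j)) i.
under eq_fun do rewrite mxE; apply: (meas_wrtM (sF j.+1)).
  exact: Filt_noise.
by have [] := @L2_mono _ _ _ P _ _ _ _ (Filt_mono (leqnSn j)) (LDr (C j) (D j)) i.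
Qed.

(** Real-valued form of [cost], used to expand in [R] instead of the extended reals; [costE]
    identifies the two on admissible data. *)
Definition Rcost k y u : R :=
  \sum_(k <= l < N)
     \int[P]_om (qf (lqQ L k l) (stateX L w k y u l om) + qf (lqR L k l) (u l om))
  + \int[P]_om qf (lqG L k) (stateX L w k y u N om).

Lemma costE k y u : (k < N)%N -> L2 P (F k) y -> L2ctrl P N x0 w k u ->
  cost P N L w k y u = (Rcost k y u)%:E.
Proof.
move=> kN Ly Lu; rewrite /cost /Rcost EFinD -sumEFin.
have LX l : (k <= l <= N)%N -> L2 P (F l) (stateX L w k y u l).
  exact: state_L2.
congr (_ + _)%E.
  apply: eq_big_nat => l /[dup] klN /andP[kl lN]; rewrite integral_EFinE//.
  apply: integrable_addr; apply: integrable_qf; apply: (L2_sqintV (@FT l)).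
    by apply: LX; rewrite kl ltnW.
  exact: Lu.
rewrite integral_EFinE//; apply: integrable_qf; apply: (L2_sqintV (@FT N)).
by apply: LX; rewrite leqnn ltnW.
Qed.

(** The perturbation direction: a control acting at time [k] only. The state it drives from 0 is the
    process [Y^k] of the convexity condition. *)
Definition impulse k (v : T -> 'cV[R]_m) (j : nat) : T -> 'cV[R]_m :=
  if j == k then v else fun=> 0.

Lemma L2_impulse k v : L2 P (F k) v -> L2ctrl P N x0 w k (impulse k v).
Proof.
move=> Lv l _; rewrite /impulse; case: eqP => [-> //|_].
exact: (L2_cst0 _ (sF l)).
Qed.

(** The impulse vanishes after [k], so among the running control costs only the one at [k]
    survives. *)
Lemma convex_functionalE k v : (k < N)%N -> L2 P (F k) v ->
  convex_functional P N L w k v = (Rcost k (fun=> 0) (impulse k v))%:E.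
Proof.
move=> kN Lv; rewrite /convex_functional -/(impulse k v) /Rcost.
set Y := stateX L w k (fun=> 0) (impulse k v).
have Li := L2_impulse Lv.
have L0 : L2 P (F k) (fun=> 0 : 'cV[R]_n) by exact: L2_cst0.
have sY l : (k <= l <= N)%N -> sqintV P (Y l).
  by move=> kl; apply: (L2_sqintV (@FT l)); exact: state_L2.
have IR l : (k <= l < N)%N -> L1 (fun om => qf (lqR L k l) (impulse k v l om)).
  by move=> kl; apply/integrable_qf/(L2_sqintV (@FT l))/Li.
have IQ l : (k <= l < N)%N -> L1 (fun om => qf (lqQ L k l) (Y l om)).
  by move=> /andP[kl lN]; apply/integrable_qf/sY; rewrite kl ltnW.
rewrite EFinD integral_EFinE; last by apply/integrable_qf/(L2_sqintV (@FT k)).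
rewrite integral_EFinE; last by apply/integrable_qf/sY; rewrite leqnn ltnW.
congr (_ + _)%E.
under eq_big_nat => l kl do rewrite integral_EFinE ?IQ//.
rewrite sumEFin -EFinD; congr EFin; apply/esym.
under eq_big_nat => l kl do rewrite RintegralD ?IQ ?IR//.
rewrite big_split /=; congr (_ + _).
rewrite big_ltn// [X in _ + X]big_nat_cond big1 ?addr0; last first.
  move=> l /andP[/andP[kl _] _]; rewrite /impulse gtn_eqF//.
  under eq_Rintegral do rewrite qfE mulmx0 dotv0l.
  by rewrite Rintegral_cst// mul0r.
by apply: eq_Rintegral => om _; rewrite /impulse eqxx.
Qed.

Lemma stateXD k y (u u' : nat -> T -> 'cV[R]_m) (l : nat) om :
  stateX L w k y (fun j om => u j om + u' j om) l om =
  stateX L w k y u l om + stateX L w k (fun=> 0) u' l om.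
Proof.
rewrite -[in RHS](scale1r (stateX L w k (fun=> 0) u' l om)).
have := state_linear (lqA L k) (lqC L k) (lqB L k) (lqD L k) w k 1 u u' y (fun=> 0) l.
move=> /(congr1 (fun f : T -> 'cV[R]_n => f om)) /=; rewrite /stateX => <-.
by congr (state _ _ _ _ _ _ _ _ _ _); [apply/funext => j|]; apply/funext => ?;
  rewrite scale1r// addr0.
Qed.

(** Exact second-order expansion. By linearity the state splits as [X + Y] with [Y] started from 0,
    and each symmetric weight contributes a value at [X], a doubled cross term and a value at
    [Y]. *)
Lemma RcostD k y u u' : (k < N)%N -> L2 P (F k) y ->
  L2ctrl P N x0 w k u -> L2ctrl P N x0 w k u' ->
  let X := stateX L w k y u in let Y := stateX L w k (fun=> 0) u' in
  Rcost k y (fun j om => u j om + u' j om) = Rcost k y u +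
    2 * (\sum_(k <= l < N) (\int[P]_om dotv (lqQ L k l *m X l om) (Y l om) +
            \int[P]_om dotv (lqR L k l *m u l om) (u' l om)) +
         \int[P]_om dotv (lqG L k *m X N om) (Y N om)) +
    Rcost k (fun=> 0) u'.
Proof.
move=> kN Ly Lu Lu' X Y.
have L0 : L2 P (F k) (fun=> 0 : 'cV[R]_n) by exact: L2_cst0.
have sX l : (k <= l <= N)%N -> sqintV P (X l).
  by move=> kl; apply: (L2_sqintV (@FT l)); exact: state_L2.
have sY l : (k <= l <= N)%N -> sqintV P (Y l).
  by move=> kl; apply: (L2_sqintV (@FT l)); exact: state_L2.
have su l : (k <= l < N)%N -> sqintV P (u l).
  by move=> kl; exact/(L2_sqintV (@FT l))/Lu.
have su' l : (k <= l < N)%N -> sqintV P (u' l).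
  by move=> kl; exact/(L2_sqintV (@FT l))/Lu'.
have E p (M : 'M[R]_p) (a b : T -> 'cV[R]_p) : M^T = M ->
    sqintV P a -> sqintV P b ->
    \int[P]_om qf M (a om + b om) = \int[P]_om qf M (a om) +
      2 * \int[P]_om dotv (M *m a om) (b om) + \int[P]_om qf M (b om).
  move=> sM sa sb; have Iab : L1 (fun om => dotv (M *m a om) (b om)).
    by apply: integrable_dotv => //; exact: sqintV_mulmx.
  have [Ia Ib] := (integrable_qf M sa, integrable_qf M sb).
  rewrite -RintegralZl// -!RintegralD//.
  - by apply: eq_Rintegral => om _; rewrite qfD.
  - exact: integrable_addr Ia (integrable_scaler _ Iab).
  - exact: integrable_scaler.
rewrite /Rcost -/X -/Y.
have kNN : (k <= N <= N)%N by rewrite leqnn ltnW.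
under eq_Rintegral do rewrite stateXD -/X -/Y.
rewrite (E _ _ _ _ (HG kN) (sX _ kNN) (sY _ kNN)).
under eq_big_nat => l kl.
  have klN : (k <= l <= N)%N by case/andP: kl => -> /ltnW ->.
  under eq_Rintegral do rewrite stateXD -/X -/Y.
  rewrite RintegralD//; first last.
  - by apply: integrable_qf; apply: sqintVD; [exact: su|exact: su'].
  - by apply: integrable_qf; apply: sqintVD; [exact: sX|exact: sY].
  rewrite (E _ _ _ _ (HQ kl) (sX _ klN) (sY _ klN)).
  rewrite (E _ _ _ _ (HR kl) (su _ kl) (su' _ kl)).
  over.
under [X in _ = X + _ + _ + _]eq_big_nat => l kl.
  have klN : (k <= l <= N)%N by case/andP: kl => -> /ltnW ->.
  rewrite RintegralD//; [|exact/integrable_qf/sX|exact/integrable_qf/su].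
  over.
under [X in _ = _ + (X + _)]eq_big_nat => l kl.
  have klN : (k <= l <= N)%N by case/andP: kl => -> /ltnW ->.
  rewrite RintegralD//; [|exact/integrable_qf/sY|exact/integrable_qf/su'].
  over.
rewrite mulrDr mulr_sumr [in RHS](addrACA (\sum_(_ <= _ < _) _)) [RHS]addrACA.
rewrite -!big_split; congr (_ + _).
by apply: eq_big_nat => l _ /=; ring.
Qed.

(** * The backward equation: existence and integrability *)

Definition bsde_step k (X : nat -> T -> 'cV[R]_n) (Z : nat -> T -> 'cV[R]_n) l :=
  exists Y1 Y2 : T -> 'cV[R]_n,
    [/\ condexpV P (F l) (Z l.+1) Y1,
        condexpV P (F l) (fun om => w l om *: Z l.+1 om) Y2 &
        {ae P, forall om, Z l om = (lqA L k l)^T *m Y1 om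
            + (lqC L k l)^T *m Y2 om + lqQ L k l *m X l om}].

Lemma sqintV_integrable p (Z : T -> 'cV[R]_p) i :
  sqintV P Z -> L1 (fun om => Z om i 0).
Proof.
move=> sZ; have s1 : sqint P (fun=> 1).
  split; first exact: measurable_cst.
  by under eq_fun do rewrite expr1n; exact: finite_measure_integrable_cst.
by apply: eq_integrable (sqintM s1 (sZ i)) => // om _; rewrite /= mul1r.
Qed.

(** Backward induction from [N], with [i] the number of steps taken. The invariant includes square
    integrability of the latest [Z], which makes the next two conditional expectations exist. *)
Lemma bsde_exists k X : (k < N)%N ->
  (forall l, (k <= l <= N)%N -> L2 P (F l) (X l)) ->
  exists Z : nat -> T -> 'cV[R]_n, (forall om, Z N om = lqG L k *m X N om) /\
    forall l, (k <= l < N)%N -> bsde_step k X Z l.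
Proof.
move=> kN LX.
have sX l : (k <= l <= N)%N -> sqintV P (X l).
  by move=> kl; exact/(L2_sqintV (@FT l))/LX.
suff H i : (i <= N - k)%N -> exists Z : nat -> T -> 'cV[R]_n,
    [/\ forall om, Z N om = lqG L k *m X N om,
       forall l, (N - i <= l < N)%N -> bsde_step k X Z l &
       sqintV P (Z (N - i)%N)].
  have [Z [ZN Zstep _]] := H (N - k)%N (leqnn _).
  by exists Z; split => // l kl; apply: Zstep; rewrite subKn// ltnW.
elim: i => [_|i IH iN].
  exists (fun _ om => lqG L k *m X N om); split => //.
    by move=> l; rewrite subn0 ltnNge => /andP[->].
  by apply/sqintV_mulmx/sX; rewrite leqnn ltnW.
have {IH} [Z [ZN Zstep sZ]] := IH (ltnW iN).
pose j := (N - i.+1)%N.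
have jS : (N - i)%N = j.+1 by rewrite /j; lia.
have kj : (k <= j < N)%N by apply/andP; rewrite /j; lia.
rewrite jS in sZ.
have [Y1 cY1] := condexpV_exists (sF j) (@FT j) (fun i => sqintV_integrable i sZ).
have IwZ i' : L1 (fun om => (w j om *: Z j.+1 om) i' 0).
  under eq_fun do rewrite mxE.
  by apply: sqintM (sZ i'); exact: sqint_noise (Hvar j).
have [Y2 cY2] := condexpV_exists (sF j) (@FT j) IwZ.
have sY1 := condexpV_sqintV (sF j) (@FT j) sZ cY1.
have sY2 := condexpV_noise_sqintV (sF j) (@FT j) (Hw j) (Hvar j) sZ cY2.
pose Zj om := (lqA L k j)^T *m Y1 om + (lqC L k j)^T *m Y2 om + lqQ L k j *m X j om.
(* Only the value at [j] is replaced. The steps after [j] involve [Z] at later times only, so they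
   are unaffected. *)
exists (fun l => if l == j then Zj else Z l); split.
- by move=> om /=; rewrite gtn_eqF//; case/andP: kj.
- move=> l; rewrite -/j leq_eqVlt => /andP[/orP[/eqP <-|jl] lN].
    by exists Y1, Y2; rewrite /= gtn_eqF// eqxx; split => //; exact: nearW.
  have [e1 e2] : (l == j) = false /\ (l.+1 == j) = false by lia.
  rewrite /bsde_step e1 e2.
  by apply: Zstep; rewrite jS jl.
- rewrite -/j /= eqxx; apply: sqintVD; last first.
    by apply/sqintV_mulmx/sX; case/andP: kj => -> /ltnW ->.
  by apply: sqintVD; exact: sqintV_mulmx.
Qed.

Lemma bsde_sqintV k X Z : (k < N)%N ->
  (forall l, (k <= l <= N)%N -> L2 P (F l) (X l)) ->
  (forall om, Z N om = lqG L k *m X N om) ->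
  (forall l, (k <= l < N)%N -> bsde_step k X Z l) ->
  forall l, (k < l <= N)%N -> sqintV P (Z l).
Proof.
move=> kN LX ZN Zstep.
have sX l : (k <= l <= N)%N -> sqintV P (X l).
  by move=> kl; exact/(L2_sqintV (@FT l))/LX.
suff H i : (i < N - k)%N -> sqintV P (Z (N - i)%N).
  move=> l /andP[kl lN]; rewrite -(subKn lN); apply: H; lia.
elim: i => [_|i IH iN].
  rewrite subn0 (_ : Z N = fun om => lqG L k *m X N om); last exact/funext.
  by apply/sqintV_mulmx/sX; rewrite leqnn ltnW.
have {IH} := IH (ltnW iN).
pose j := (N - i.+1)%N; have -> : (N - i)%N = j.+1 by rewrite /j; lia.
rewrite -/j => sZ.
have [kj jN] : (k < j)%N /\ (j < N)%N by rewrite /j; lia.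
have /Zstep[Y1 [Y2 [cY1 cY2 Zj]]] : (k <= j < N)%N by rewrite ltnW.
(* The preceding step conditions [Z j], hence makes it measurable; the almost sure equation at [j]
   then supplies the second moment. *)
have /Zstep[Y1' [_ [cZ _ _]]] : (k <= j.-1 < N)%N by lia.
rewrite (ltn_predK kj) in cZ.
have sY1 := condexpV_sqintV (sF j) (@FT j) sZ cY1.
have sY2 := condexpV_noise_sqintV (sF j) (@FT j) (Hw j) (Hvar j) sZ cY2.
have sQ : sqintV P (fun om => (lqA L k j)^T *m Y1 om + (lqC L k j)^T *m Y2 om
    + lqQ L k j *m X j om).
  apply: sqintVD; last by apply/sqintV_mulmx/sX; rewrite (ltnW kj) (ltnW jN).
  by apply: sqintVD; exact: sqintV_mulmx.
move=> i'; apply: ae_eq_sqint (sQ i').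
  by have [_ /integrable_measurable] := cZ i'.
by apply: filterS Zj => om ->.
Qed.

Lemma RcostZ k c v : (k < N)%N -> L2 P (F k) v ->
  Rcost k (fun=> 0) (impulse k (fun om => c *: v om)) =
  c ^+ 2 * Rcost k (fun=> 0) (impulse k v).
Proof.
move=> kN Lv; rewrite /Rcost.
have -> : impulse k (fun om => c *: v om) = fun j om => c *: impulse k v j om.
  apply/funext => j; apply/funext => om; rewrite /impulse.
  by case: eqP => // _; rewrite scaler0.
have -> : stateX L w k (fun=> 0) (fun j om => c *: impulse k v j om) =
    fun j om => c *: stateX L w k (fun=> 0) (impulse k v) j om.
  apply/funext => j; rewrite /stateX -stateZ.
  by congr (state _ _ _ _ _ _ _ _ _); apply/funext => om; rewrite scaler0.
set Y := stateX L w k (fun=> 0) (impulse k v).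
have Li := L2_impulse Lv.
have L0 : L2 P (F k) (fun=> 0 : 'cV[R]_n) by exact: L2_cst0.
have sY l : (k <= l <= N)%N -> sqintV P (Y l).
  by move=> kl; apply: (L2_sqintV (@FT l)); exact: state_L2.
rewrite mulrDr mulr_sumr; congr (_ + _); last first.
  under eq_Rintegral do rewrite qfZ.
  by rewrite RintegralZl//; apply/integrable_qf/sY; rewrite leqnn ltnW.
apply: eq_big_nat => l kl; under eq_Rintegral do rewrite !qfZ -mulrDr.
rewrite RintegralZl//; apply: integrable_addr; apply: integrable_qf.
  by apply: sY; case/andP: kl => -> /ltnW.
exact/(L2_sqintV (@FT l))/Li.
Qed.

(** Telescoping. After [k] the impulse is off, so [Y] moves by [A] and [C] alone; transposing that
    step onto [Z] and adding the [Q] term turns the pairing at [j.+1] into the pairing at [j]. The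
    bound on [i] stops the recursion at [k.+1], where the control still acts. *)
Lemma bsde_adjoint k X Z v : (k < N)%N ->
  (forall l, (k <= l <= N)%N -> L2 P (F l) (X l)) -> L2 P (F k) v ->
  (forall om, Z N om = lqG L k *m X N om) ->
  (forall l, (k <= l < N)%N -> bsde_step k X Z l) ->
  let Y := stateX L w k (fun=> 0) (impulse k v) in
  forall i, (i < N - k)%N -> \int[P]_om dotv (Z (N - i)%N om) (Y (N - i)%N om) =
    \sum_(N - i <= l < N) \int[P]_om dotv (lqQ L k l *m X l om) (Y l om) +
    \int[P]_om dotv (lqG L k *m X N om) (Y N om).
Proof.
move=> kN LX Lv ZN Zstep Y.
have LY l : (k <= l <= N)%N -> L2 P (F l) (Y l).
  by move=> kl; apply: state_L2 => //; [exact: L2_cst0|exact: L2_impulse].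
have sX l : (k <= l <= N)%N -> sqintV P (X l).
  by move=> kl; exact/(L2_sqintV (@FT l))/LX.
have sY l : (k <= l <= N)%N -> sqintV P (Y l).
  by move=> kl; exact/(L2_sqintV (@FT l))/LY.
have sZ := bsde_sqintV kN LX ZN Zstep.
elim=> [_|i IH iN].
  by rewrite subn0 big_geq// add0r; under eq_Rintegral do rewrite ZN.
have {IH} := IH (ltnW iN).
pose j := (N - i.+1)%N; have -> : (N - i)%N = j.+1 by rewrite /j; lia.
rewrite -/j; have [kj jN] : (k < j)%N /\ (j < N)%N by rewrite /j; lia.
have kjN : (k <= j <= N)%N by lia.
have sZj := sZ j.+1 (introT andP (conj (ltnW kj) jN)).
have /Zstep[Y1 [Y2 [cY1 cY2 Zj]]] : (k <= j < N)%N by rewrite ltnW.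
have sY1 := condexpV_sqintV (sF j) (@FT j) sZj cY1.
have sY2 := condexpV_noise_sqintV (sF j) (@FT j) (Hw j) (Hvar j) sZj cY2.
have sA : sqintV P (fun om => (lqA L k j)^T *m Y1 om + (lqC L k j)^T *m Y2 om).
  by apply: sqintVD; exact: sqintV_mulmx.
have sQ := sqintV_mulmx (lqQ L k j) (sX _ kjN).
under eq_Rintegral => om _.
  rewrite /Y /stateX stateS ?(ltnW kj)// /impulse gtn_eqF// !mulmx0 !addr0.
  over.
rewrite (Rintegral_dotv_adjoint (sF j) (@FT j) _ _ (Hw j) (Hvar j) sZj cY1 cY2 (LY j kjN)).
move=> E; rewrite big_ltn// -addrA -E -RintegralD//; [|exact: integrable_dotv (sY _ _)..].
apply: ae_eq_Rintegral.
- apply/integrable_measurable/integrable_dotv; last exact: sY.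
  by apply: sZ; rewrite kj ltnW.
- by apply: integrable_measurable; apply: integrable_addr; apply: integrable_dotv => //; exact: sY.
- by apply: filterS Zj => om ->; rewrite dotvDl addrC.
Qed.

(** At time [k] the state perturbation is born from [B] and [D]; transposing that step gives the
    pairing of [Z] and [Y] at [k.+1], which [bsde_adjoint] expands. *)
Lemma first_variation k (u : nat -> T -> 'cV[R]_m) X Z Y1 Y2 v : (k < N)%N ->
  L2 P (F k) (u k) ->
  (forall l, (k <= l <= N)%N -> L2 P (F l) (X l)) -> L2 P (F k) v ->
  (forall om, Z N om = lqG L k *m X N om) ->
  (forall l, (k <= l < N)%N -> bsde_step k X Z l) ->
  condexpV P (F k) (Z k.+1) Y1 ->
  condexpV P (F k) (fun om => w k om *: Z k.+1 om) Y2 ->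
  let Y := stateX L w k (fun=> 0) (impulse k v) in
  \int[P]_om dotv (lqR L k k *m u k om + (lqB L k k)^T *m Y1 om
                     + (lqD L k k)^T *m Y2 om) (v om) =
  \sum_(k <= l < N) (\int[P]_om dotv (lqQ L k l *m X l om) (Y l om) +
      \int[P]_om dotv (lqR L k l *m u l om) (impulse k v l om)) +
  \int[P]_om dotv (lqG L k *m X N om) (Y N om).
Proof.
move=> kN Luk LX Lv ZN Zstep cY1 cY2 Y.
have sZ : sqintV P (Z k.+1).
  by apply: (bsde_sqintV kN LX ZN Zstep); rewrite ltnSn.
(* The largest admissible index, for which [N - i] is [k.+1]. *)
have := bsde_adjoint kN LX Lv ZN Zstep (i := N - k.+1).
have -> : (N - (N - k.+1))%N = k.+1 by lia.
rewrite -/Y => /(_ _) E.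
have {}E := E ltac:(lia).
have sY1 := condexpV_sqintV (sF k) (@FT k) sZ cY1.
have sY2 := condexpV_noise_sqintV (sF k) (@FT k) (Hw k) (Hvar k) sZ cY2.
have [suk sv] := (L2_sqintV (@FT k) Luk, L2_sqintV (@FT k) Lv).
have Yk : Y k = fun=> 0 by rewrite /Y /stateX state_init.
have YS om : Y k.+1 om = lqB L k k *m v om + w k om *: (lqD L k k *m v om).
  by rewrite /Y /stateX stateS// state_init// /impulse eqxx !mulmx0 !add0r.
under eq_Rintegral do rewrite -addrA dotvDl.
rewrite RintegralD//; first last.
- by apply: integrable_dotv => //; apply: sqintVD; exact: sqintV_mulmx.
- by apply: integrable_dotv => //; exact: sqintV_mulmx.
rewrite -(Rintegral_dotv_adjoint (sF k) (@FT k) _ _ (Hw k) (Hvar k) sZ cY1 cY2 Lv).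
under [X in _ + X]eq_Rintegral do rewrite -YS.
rewrite E big_split /= addrA; congr (_ + _); rewrite addrC; congr (_ + _).
  (* The sum may start at [k] instead of [k.+1], because [Y] vanishes at [k]. *)
  rewrite [RHS]big_ltn// Yk.
  under [X in _ = X + _]eq_Rintegral do rewrite dotvC dotv0l.
  by rewrite Rintegral_cst// mul0r add0r.
rewrite big_ltn// [X in _ + X]big_nat_cond big1 ?addr0; last first.
  move=> l /andP[/andP[kl _] _]; rewrite /impulse gtn_eqF//.
  under eq_Rintegral do rewrite dotvC dotv0l.
  by rewrite Rintegral_cst// mul0r.
by apply: eq_Rintegral => om _; rewrite /impulse eqxx.
Qed.

(** * Deviations at a single time and the equilibrium condition *)

Lemma cost_perturbation k (u : nat -> T -> 'cV[R]_m) y Z Y1 Y2 v : (k < N)%N ->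
  L2 P (F k) y -> L2ctrl P N x0 w k u -> L2 P (F k) v ->
  let X := stateX L w k y u in
  (forall om, Z N om = lqG L k *m X N om) ->
  (forall l, (k <= l < N)%N -> bsde_step k X Z l) ->
  condexpV P (F k) (Z k.+1) Y1 ->
  condexpV P (F k) (fun om => w k om *: Z k.+1 om) Y2 ->
  cost P N L w k y (fun j => if j == k then (fun om => u k om + v om) else u j) =
  (Rcost k y u + 2 * \int[P]_om dotv (lqR L k k *m u k om
      + (lqB L k k)^T *m Y1 om + (lqD L k k)^T *m Y2 om) (v om)
    + Rcost k (fun=> 0) (impulse k v))%:E.
Proof.
move=> kN Ly Lu Lv X ZN Zstep cY1 cY2.
have Li := L2_impulse Lv.
have LX l : (k <= l <= N)%N -> L2 P (F l) (X l) by exact: state_L2.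
have Luk : L2 P (F k) (u k) by apply: Lu; rewrite leqnn.
have -> : (fun j => if j == k then (fun om => u k om + v om) else u j) =
    fun j om => u j om + impulse k v j om.
  apply/funext => j; apply/funext => om; rewrite /impulse.
  by case: eqP => [->//|_]; rewrite addr0.
rewrite costE//; last first.
  by move=> l kl; apply: (L2D (sF l) (@FT l)); [exact: Lu|exact: Li].
by rewrite RcostD// (first_variation kN Luk LX Lv ZN Zstep cY1 cY2).
Qed.

(** The equivalence at one fixed time. The backward process exists for any control; optimality is
    needed only for stationarity and convexity. *)
Lemma equilibrium_stepP k (u : nat -> T -> 'cV[R]_m) y : (k < N)%N ->
  L2 P (F k) y -> L2ctrl P N x0 w k u ->
  let X := stateX L w k y u in
  (forall v, L2 P (F k) v ->
    (cost P N L w k y u <= cost P N L w k y (fun j => if j == k then v else u j))%E)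
  <->
  (exists Z : nat -> T -> 'cV[R]_n,
    (forall om, Z N om = lqG L k *m X N om) /\
    (forall l, (k <= l < N)%N -> bsde_step k X Z l) /\
    (exists Y1 Y2 : T -> 'cV[R]_n,
      [/\ condexpV P (F k) (Z k.+1) Y1,
          condexpV P (F k) (fun om => w k om *: Z k.+1 om) Y2 &
          {ae P, forall om, 0 = lqR L k k *m u k om
             + (lqB L k k)^T *m Y1 om + (lqD L k k)^T *m Y2 om}])) /\
  (0 <= ereal_inf [set convex_functional P N L w k ub |
                    ub in [set ub | L2 P (F k) ub]])%E.
Proof.
move=> kN Ly Lu X.
have LX l : (k <= l <= N)%N -> L2 P (F l) (X l) by exact: state_L2.
have Luk : L2 P (F k) (u k) by apply: Lu; rewrite leqnn.
(* The stationarity residual is itself an admissible direction, so that it can be tested against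
   itself. *)
have LS (Z : nat -> T -> 'cV[R]_n) Y1 Y2 :
    (forall om, Z N om = lqG L k *m X N om) ->
    (forall l, (k <= l < N)%N -> bsde_step k X Z l) ->
    condexpV P (F k) (Z k.+1) Y1 ->
    condexpV P (F k) (fun om => w k om *: Z k.+1 om) Y2 ->
    L2 P (F k) (fun om => lqR L k k *m u k om + (lqB L k k)^T *m Y1 om
                          + (lqD L k k)^T *m Y2 om).
  move=> ZN Zstep cY1 cY2.
  have sZ : sqintV P (Z k.+1).
    by apply: (bsde_sqintV kN LX ZN Zstep); rewrite ltnSn.
  have sY1 := condexpV_sqintV (sF k) (@FT k) sZ cY1.
  have sY2 := condexpV_noise_sqintV (sF k) (@FT k) (Hw k) (Hvar k) sZ cY2.
  have LY1 : L2 P (F k) Y1.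
    by move=> i; have [? _ _ _] := cY1 i; split => //; have [] := sY1 i.
  have LY2 : L2 P (F k) Y2.
    by move=> i; have [? _ _ _] := cY2 i; split => //; have [] := sY2 i.
  apply: (L2D (sF k) (@FT k)); last exact: (L2_mulmx (sF k) (@FT k)).
  by apply: (L2D (sF k) (@FT k)); exact: (L2_mulmx (sF k) (@FT k)).
split=> [opt|[[Z [ZN [Zstep [Y1 [Y2 [cY1 cY2 S0]]]]]] conv] v Lv].
- have [Z [ZN Zstep]] := bsde_exists kN LX.
  have kk : (k <= k < N)%N by rewrite leqnn.
  have [Y1 [Y2 [cY1 cY2 _]]] := Zstep k kk.
  have {}LS := LS Z Y1 Y2 ZN Zstep cY1 cY2.
  pose S om := lqR L k k *m u k om + (lqB L k k)^T *m Y1 om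
               + (lqD L k k)^T *m Y2 om.
  have sS := L2_sqintV (@FT k) LS.
  have var v : L2 P (F k) v -> \int[P]_om dotv (S om) (v om) = 0 /\
      0 <= Rcost k (fun=> 0) (impulse k v).
    (* Optimality is tested on the deviations [u k + c v], for every real [c]. *)
    move=> Lv; apply: quadratic_ge0 => c.
    have Lcv : L2 P (F k) (fun om => c *: v om) by exact: (L2Z (sF k) (@FT k)).
    have := opt _ (L2D (sF k) (@FT k) Luk Lcv).
    rewrite (cost_perturbation kN Ly Lu Lcv ZN Zstep cY1 cY2) costE//.
    rewrite lee_fin RcostZ//.
    under eq_Rintegral do rewrite dotvZr.
    rewrite RintegralZl//; first by rewrite -/S; lra.
    by apply: integrable_dotv => //; exact/(L2_sqintV (@FT k)).
  split; last first.
    apply: le_ereal_inf_tmp => _ [v Lv <-].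
    by rewrite convex_functionalE// lee_fin; have [] := var v Lv.
  exists Z; split => //; split => //; exists Y1, Y2; split => //.
  have ISS := integrable_dotv sS sS.
  have := Rintegral_ge0_eq0 ISS (fun om => dotv_ge0 _) (var _ LS).1.
  by apply: filterS => om /dotv_eq0 ->.
(* An arbitrary competitor [v] is the perturbation of [u k] by [v']. *)
- pose v' om := v om - u k om.
  have Lv' : L2 P (F k) v'.
    apply: (L2D (sF k) (@FT k)) => //.
    have := L2Z (sF k) (@FT k) (- 1) Luk.
    by under eq_fun do rewrite scaleN1r.
  have -> : (fun j => if j == k then v else u j) =
      fun j => if j == k then (fun om => u k om + v' om) else u j.
    apply/funext => j; case: eqP => // _; apply/funext => om.
    by rewrite /v' addrC subrK.
  rewrite (cost_perturbation kN Ly Lu Lv' ZN Zstep cY1 cY2) costE// lee_fin.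
  (* Stationarity kills the first-order term; what remains is the convex functional at [v']. *)
  rewrite (@ae_eq_Rintegral _ _ _ P _ (fun=> 0)).
  + rewrite Rintegral_cst// mul0r mulr0 addr0 lerDl.
    rewrite -lee_fin -convex_functionalE//; apply: le_trans conv _.
    by apply: ereal_inf_lbound; exists v'.
  + apply/integrable_measurable/integrable_dotv; apply: (L2_sqintV (@FT k)) => //.
    exact: LS ZN Zstep cY1 cY2.
  + exact: measurable_cst.
  + by apply: filterS S0 => om <-; rewrite dotv0l.
Qed.

(** Both sides quantify over [k], so [equilibrium_stepP] applies time by time. The equilibrium state
    at [k] is an admissible initial datum by [state_L2] with the diagonal coefficients. *)
Lemma equilibriumP t x u : (t < N)%N -> L2 P (F t) x -> L2ctrl P N x0 w t u ->
  open_loop_equilibrium P N L x0 w t x u <-> condition_ii P N L x0 w t x u.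
Proof.
move=> tN Lx Lu.
have LXs k : (t <= k < N)%N -> L2 P (F k) (Xstar L w t x u k).
  by move=> /andP[tk /ltnW kN]; apply: state_L2 => //; rewrite tk.
have Luk k : (t <= k < N)%N -> L2ctrl P N x0 w k u.
  move=> /andP[tk _] l /andP[kl lN]; apply: Lu.
  by rewrite (leq_trans tk).
split=> [[_ opt] k tk|ii].
- have [_ kN] := andP tk.
  have [+ _] := equilibrium_stepP kN (LXs k tk) (Luk k tk).
  by apply; exact: opt.
- split=> // k tk; have [_ kN] := andP tk.
  have [_] := equilibrium_stepP kN (LXs k tk) (Luk k tk).
  by apply; exact: ii.
Qed.

End LQProblem.

Unset Implicit Arguments.
Set Strict Implicit.
Set Printing Implicit Defensive.

Theorem theorem2p1 (R : realType) (d : measure_display) (T : measurableType d)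
  (P : probability T R) (n m N : nat) (L : LQdata R n m)
  (x0 : T -> 'cV[R]_n) (w : nat -> T -> R)
  (HN : (0 < N)%N)
  (HQ : forall t k, (t <= k < N)%N -> (lqQ L t k)^T = lqQ L t k)
  (HR : forall t k, (t <= k < N)%N -> (lqR L t k)^T = lqR L t k)
  (HG : forall t, (t < N)%N -> (lqG L t)^T = lqG L t)
  (Hx0 : forall i : 'I_n, measurable_fun setT (fun om => x0 om i 0))
  (Hw : forall k, measurable_fun setT (w k))
  (Hmean : forall k, condexp P (Filt x0 w k) (w k) (fun _ => 0))
  (Hvar : forall k, condexp P (Filt x0 w k) (fun om => w k om ^+ 2) (fun _ => 1))
  (t : nat) (x : T -> 'cV[R]_n)
  (Ht : (t < N)%N) (Hx : L2 P (Filt x0 w t) x) :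
  ((exists u, open_loop_equilibrium P N L x0 w t x u) <->
   (exists u, L2ctrl P N x0 w t u /\ condition_ii P N L x0 w t x u)) /\
  (forall u, L2ctrl P N x0 w t u -> condition_ii P N L x0 w t x u ->
     open_loop_equilibrium P N L x0 w t x u).
Proof.
have iff u (Lu : L2ctrl P N x0 w t u) :=
  equilibriumP HQ HR HG Hx0 Hw Hvar Ht Hx Lu.
split; last by move=> u Lu; exact: (iff u Lu).2.
split=> [[u eq]|[u [Lu ii]]]; exists u; last exact/(iff u Lu).
by have [Lu _] := eq; split => //; exact/(iff u Lu).
Qed.
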